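(* Suppose Assumptions 1 and 2 hold, $Q\succeq0$ satisfies $\mathrm{null}(\Pi_{2u}\Pi_{2u}^\top)\cap\mathrm{null}(Q)=\{0\}$, and $\mu\ge\max\{\hat L_f,L_h\}$. Then for every $\gamma>0$ there exist $\epsilon>0$, $\rho>0$, $\varphi_1,\varphi_2\ge0$ and a matrix $\mathbf P\succ0$ such that $\mathbf A^\gamma_{\epsilon\rho}$ satisfies $\mathrm{LMI}(\mathbf P,\Xi_\varphi)$.
   Context: Let $A\in\mathbb R^{n\times n}$ be Hurwitz, $B\in\mathbb R^{n\times p}$, $B_w\in\mathbb R^{n\times q}$, and for $i=1,2$ let $C_i\in\mathbb R^{r_i\times n}$, $D_{iw}\in\mathbb R^{r_i\times q}$. Define $\Pi_{iu}:=-C_iA^{-1}B$ and $\Pi_{iw}:=-C_iA^{-1}B_w+D_{iw}$. For $t\ge0$ let $f^t:\mathbb R^p\to\mathbb R$, $h^t:\mathbb R^{r_1}\to\mathbb R$ and $g^t:\mathbb R^{r_2}\to\mathbb R\cup\{+\infty\}$ be given, let $w:[0,\infty)\to\mathbb R^q$, and fix $\mu>0$ and $Q\in\mathbb R^{r_2\times r_2}$. Definitions. - $M_{\mu g}(v):=\min_x g(x)+\frac1{2\mu}\|x-v\|^2$ is the Moreau envelope. - $\mathcal P(t)$: minimize $f^t(u)+h^t(y_1)+g^t(y_2)$ subject to $y_i=\Pi_{iu}u+\Pi_{iw}w(t)$. - Its optimal primal-dual pairs are saddle points of $f^t(u)+h^t(\Pi_{1u}u+\Pi_{1w}w(t))+M_{\mu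 g^t}(\Pi_{2u}u+\Pi_{2w}w(t)+\mu\lambda)-\frac\mu2\|\lambda\|^2$. Assumptions. - Assumption 1: for all $t$, $f^t$ is $m$-strongly convex with $L_f$-Lipschitz gradient, $h^t$ is convex with $L_h$-Lipschitz gradient, and $g^t$ is proper, convex and lsc. - Assumption 2: $\mathcal P(t)$ is feasible for all $t\ge0$ and $t\mapsto(u^\star(t),\lambda^\star(t))$ is measurable. Regularized algorithm. For $\gamma>0$ the regularized closed loop is $$\dot x=Ax+Bu+B_ww,\quad \dot u=-\nabla f^t(u)-\Pi_{1u}^\top\nabla h^t(y_1)-\Pi_{2u}^\top\nabla M_{\mu g^t}(y_2+\mu\lambda),\quad \dot\lambda=\mu(\nabla M_{\mu g^t}(y_2+\mu\lambda)-\lambda)-\gamma Q\lambda.$$ Matrices. Let $\hat L_f:=L_f-m$. For $\epsilon>0$ and $\rho\ge0$ define $$\mathbf A^\gamma_\epsilon:=\begin{bmatrix}\frac1\epsilon A&\frac1\epsilon B&0\\0&-mI&0\\0&0&-\mu I-\gamma Q\end{bmatrix},\qquad \mathbf A^\gamma_{\epsilon\rho}:=\mathbf A^\gamma_\epsilon+\rho I,$$ $$\mathbf B=\begin{bmatrix}0&0&0\\-I&-\Pi_{1u}^\top&-\frac1\mu\Pi_{2u}^\top\\0&0&I\end{bmatrix},\qquad \mathbf C=\begin{bmatrix}0&I&0\\C_1&0&0\\C_2&0&\mu I\end{bmatrix}.$$ LMI condition. For $\varphi_1,\varphi_2\ge0$, $\Xi_\varphi$ is the $6\times6$ block matrix,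 with block sizes $(p,r_1,r_2,p,r_1,r_2)$, whose nonzero blocks are: - $(1,4)=(4,1)=\varphi_1\hat L_fI$ and $(4,4)=-2\varphi_1I$; - $(2,5)=(5,2)=\varphi_2L_hI$ and $(5,5)=-2\varphi_2I$; - $(3,6)=(6,3)=I$ and $(6,6)=-2I$. A matrix $\mathbf A'$ satisfies $\mathrm{LMI}(\mathbf P,\Xi_\varphi)$ if $\begin{bmatrix}\mathbf A'^\top\mathbf P+\mathbf P\mathbf A'&\mathbf P\mathbf B\\\mathbf B^\top\mathbf P&0\end{bmatrix}+\begin{bmatrix}\mathbf C^\top&0\\0&I\end{bmatrix}\Xi_\varphi\begin{bmatrix}\mathbf C&0\\0&I\end{bmatrix}\preceq0$. *)

(* Defs.v *)
From HB Require Import structures.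
From mathcomp Require Import all_boot all_order all_algebra.
From mathcomp Require Import all_classical all_reals all_analysis.
From mathcomp Require Import complex.

Set Implicit Arguments.
Unset Strict Implicit.
Unset Printing Implicit Defensive.

Import Order.TTheory GRing.Theory Num.Theory.
Import numFieldNormedType.Exports.
Local Open Scope classical_set_scope.
Local Open Scope ring_scope.

Section Defs.
Variable R : realType.

Definition norm2 {k : nat} (x : 'cV[R]_k) : R := Num.sqrt ((x^T *m x) 0 0).

Definition ip {k : nat} (x y : 'cV[R]_k) : R := (x^T *m y) 0 0.

Definition grad {k : nat} (f : 'cV[R]_k -> R) (u : 'cV[R]_k) : 'cV[R]_k :=
  \col_i ('D_(delta_mx i 0) f u).

Definition lipschitz_gradient {k : nat} (f : 'cV[R]_k -> R) (L : R) : Prop :=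
  (forall u, differentiable f u) /\
  forall u v, norm2 (grad f u - grad f v) <= L * norm2 (u - v).

Definition strongly_convex {k : nat} (f : 'cV[R]_k -> R) (m : R) : Prop :=
  0 < m /\
  forall u v (l : R), 0 <= l <= 1 ->
    f (l *: u + (1 - l) *: v) <=
      l * f u + (1 - l) * f v - m / 2 * l * (1 - l) * norm2 (u - v) ^+ 2.

Definition convex_fun {k : nat} (f : 'cV[R]_k -> R) : Prop :=
  forall u v (l : R), 0 <= l <= 1 ->
    f (l *: u + (1 - l) *: v) <= l * f u + (1 - l) * f v.

Definition convex_efun {k : nat} (g : 'cV[R]_k -> \bar R) : Prop :=
  forall (u v : 'cV[R]_k) (l : R), 0 < l < 1 ->
    (g (l *: u + (1 - l) *: v)%R <= l%:E * g u + (1 - l)%:E * g v)%E.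

Definition proper_efun {k : nat} (g : 'cV[R]_k -> \bar R) : Prop :=
  (exists x, g x < +oo)%E /\ (forall x, -oo < g x)%E.

Definition moreau {k : nat} (mu : R) (g : 'cV[R]_k -> \bar R) (v : 'cV[R]_k)
  : \bar R :=
  ereal_inf [set (g x + ((2 * mu)^-1 * norm2 (x - v) ^+ 2)%:E)%E | x in setT].

Definition psd {k : nat} (M : 'M[R]_k) : Prop :=
  M^T = M /\ forall x : 'cV[R]_k, 0 <= (x^T *m M *m x) 0 0.

Definition nsd {k : nat} (M : 'M[R]_k) : Prop :=
  M^T = M /\ forall x : 'cV[R]_k, (x^T *m M *m x) 0 0 <= 0.

Definition pd {k : nat} (M : 'M[R]_k) : Prop :=
  M^T = M /\ forall x : 'cV[R]_k, x != 0 -> 0 < (x^T *m M *m x) 0 0.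

Definition hurwitz {k : nat} (A : 'M[R]_k) : Prop :=
  forall z : R[i], eigenvalue (map_mx (fun x => (x%:C)%C) A) z -> complex.Re z < 0.

Definition Amat {n p r2 : nat} (A : 'M[R]_n) (B : 'M[R]_(n, p))
  (Q : 'M[R]_r2) (m mu gamma eps : R) : 'M[R]_(n + p + r2) :=
  block_mx (block_mx (eps^-1 *: A) (eps^-1 *: B) 0 (- m%:M))
           0 0 (- mu%:M - gamma *: Q).

Definition Bmat {n p r1 r2 : nat} (Pi1u : 'M[R]_(r1, p)) (Pi2u : 'M[R]_(r2, p))
  (mu : R) : 'M[R]_(n + p + r2, p + r1 + r2) :=
  block_mx (col_mx 0 (row_mx (- 1%:M) (- Pi1u^T)))
           (col_mx 0 (- (mu^-1 *: Pi2u^T)))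
           0 1%:M.

Definition Cmat {n p r1 r2 : nat} (C1 : 'M[R]_(r1, n)) (C2 : 'M[R]_(r2, n))
  (mu : R) : 'M[R]_(p + r1 + r2, n + p + r2) :=
  block_mx (col_mx (row_mx 0 1%:M) (row_mx C1 0)) 0
           (row_mx C2 0) (mu%:M).

Definition Ximat {p r1 r2 : nat} (hLf Lh phi1 phi2 : R)
  : 'M[R]_(p + r1 + r2 + (p + r1 + r2)) :=
  let X : 'M[R]_(p + r1 + r2) :=
    block_mx (block_mx (phi1 * hLf)%:M 0 0 (phi2 * Lh)%:M) 0 0 1%:M in
  let Y : 'M[R]_(p + r1 + r2) :=
    block_mx (block_mx (- 2 * phi1)%:M 0 0 (- 2 * phi2)%:M) 0 0 (- 2)%:M in
  block_mx 0 X X Y.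

Definition LMI {N M : nat} (A' : 'M[R]_N) (B : 'M[R]_(N, M)) (C : 'M[R]_(M, N))
  (P : 'M[R]_N) (Xi : 'M[R]_(M + M)) : Prop :=
  nsd (block_mx (A'^T *m P + P *m A') (P *m B) (B^T *m P) 0
       + block_mx C^T 0 0 1%:M *m Xi *m block_mx C 0 0 1%:M).


Definition Piu {n p r : nat} (A : 'M[R]_n) (B : 'M[R]_(n, p)) (C : 'M[R]_(r, n))
  : 'M[R]_(r, p) := - (C *m invmx A *m B).

Definition Piw {n q r : nat} (A : 'M[R]_n) (Bw : 'M[R]_(n, q)) (C : 'M[R]_(r, n))
  (Dw : 'M[R]_(r, q)) : 'M[R]_(r, q) := - (C *m invmx A *m Bw) + Dw.

(* the Lagrangian-type function whose saddle points are the optimal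
   primal-dual pairs of P(t) *)
Definition lagr {p q r1 r2 : nat} (f : 'cV[R]_p -> R) (h : 'cV[R]_r1 -> R)
  (g : 'cV[R]_r2 -> \bar R) (Pi1u : 'M[R]_(r1, p)) (Pi1w : 'M[R]_(r1, q))
  (Pi2u : 'M[R]_(r2, p)) (Pi2w : 'M[R]_(r2, q)) (wt : 'cV[R]_q) (mu : R)
  (u : 'cV[R]_p) (l : 'cV[R]_r2) : \bar R :=
  ((f u + h (Pi1u *m u + Pi1w *m wt))%:E
   + moreau mu g (Pi2u *m u + Pi2w *m wt + mu *: l)
   - (mu / 2 * norm2 l ^+ 2)%:E)%E.

Definition saddle_point {p r2 : nat} (L : 'cV[R]_p -> 'cV[R]_r2 -> \bar R)
  (us : 'cV[R]_p) (ls : 'cV[R]_r2) : Prop :=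
  forall u l, (L us l <= L us ls)%E /\ (L us ls <= L u ls)%E.

End Defs.

(* Main.v *)
(** Substituting xi = x + A^-1 B u turns the closed loop into a singularly
perturbed system with fast variable xi and slow variable (u, lambda).  The
certificate is P = E^T Px E + F^T Pr F, where E z = xi and F z = (u, lambda).

The fast block Px is a Lyapunov matrix of A: after a Schur triangularization
S A = T S over the complex numbers, the weighted norm with weights h^(2i) on the
coordinates of S x makes the strictly triangular part of T negligible for small h.

The slow block is Pr = mu I + k [0 Pi2^T; Pi2 0].  For k = 0 the slow LMI form is
a sum of squares that only vanishes for u = 0, zero inputs v1 = v2 = 0,
v3 = mu lambda and Q lambda = 0; there the coupling term contributes
-2 k |Pi2^T lambda|^2, which is negative by the null space condition.

Each of the small parameters k, eps, rho is produced by the same compactness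
argument (Finsler's lemma). *)

Require Import Defs.
From HB Require Import structures.
From mathcomp Require Import all_boot all_order all_algebra.
From mathcomp Require Import all_classical all_reals all_analysis.
From mathcomp Require Import complex.
From mathcomp Require Import ring lra.
Import Order.TTheory GRing.Theory Num.Theory.
Import numFieldNormedType.Exports.
Local Open Scope classical_set_scope.
Local Open Scope ring_scope.

(** * Quadratic forms *)

Definition qf {R : realType} {k : nat} (M : 'M[R]_k) (x : 'cV[R]_k) : R := (x^T *m M *m x) 0 0.

Lemma qfE {R : realType} {k : nat} (M : 'M[R]_k) x : qf M x = ip x (M *m x).
Proof. by rewrite /qf /ip mulmxA. Qed.

Lemma ipE {R : realType} {k : nat} (x y : 'cV[R]_k) : ip x y = \sum_i x i 0 * y i 0.
Proof. by rewrite /ip mxE; apply: eq_bigr => i _; rewrite mxE. Qed.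

Lemma ipC {R : realType} {k : nat} (x y : 'cV[R]_k) : ip x y = ip y x.
Proof. by rewrite !ipE; apply: eq_bigr => i _; rewrite mulrC. Qed.

Lemma ipDr {R : realType} {k : nat} (x y z : 'cV[R]_k) : ip x (y + z) = ip x y + ip x z.
Proof. by rewrite /ip mulmxDr mxE. Qed.

Lemma ipDl {R : realType} {k : nat} (x y z : 'cV[R]_k) : ip (x + y) z = ip x z + ip y z.
Proof. by rewrite ipC ipDr !(ipC z). Qed.

Lemma ipZr {R : realType} {k : nat} a (x y : 'cV[R]_k) : ip x (a *: y) = a * ip x y.
Proof. by rewrite /ip -scalemxAr mxE. Qed.

Lemma ipZl {R : realType} {k : nat} a (x y : 'cV[R]_k) : ip (a *: x) y = a * ip x y.
Proof. by rewrite ipC ipZr ipC. Qed.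

Lemma ipNr {R : realType} {k : nat} (x y : 'cV[R]_k) : ip x (- y) = - ip x y.
Proof. by rewrite -scaleN1r ipZr mulN1r. Qed.

Lemma ipNl {R : realType} {k : nat} (x y : 'cV[R]_k) : ip (- x) y = - ip x y.
Proof. by rewrite ipC ipNr ipC. Qed.

Lemma ip0r {R : realType} {k : nat} (x : 'cV[R]_k) : ip x 0 = 0.
Proof. by rewrite /ip mulmx0 mxE. Qed.

Lemma ip0l {R : realType} {k : nat} (x : 'cV[R]_k) : ip 0 x = 0.
Proof. by rewrite ipC ip0r. Qed.

Lemma ip_mull {R : realType} {k l : nat} (M : 'M[R]_(k, l)) x y :
  ip (M *m x) y = ip x (M^T *m y).
Proof. by rewrite /ip trmx_mul mulmxA. Qed.

Lemma ip_col_mx {R : realType} {k l : nat} (a c : 'cV[R]_k) (b d : 'cV[R]_l) :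
  ip (col_mx a b) (col_mx c d) = ip a c + ip b d.
Proof. by rewrite /ip tr_col_mx mul_row_col mxE. Qed.

Lemma ip_ge0 {R : realType} {k : nat} (x : 'cV[R]_k) : 0 <= ip x x.
Proof. by rewrite ipE sumr_ge0// => i _; rewrite -expr2 sqr_ge0. Qed.

Lemma ip_eq0 {R : realType} {k : nat} (x : 'cV[R]_k) : ip x x = 0 -> x = 0.
Proof.
rewrite ipE => /eqP; rewrite psumr_eq0 => [/allP x0|i _]; last by rewrite -expr2 sqr_ge0.
apply/colP => i; rewrite mxE; apply/eqP.
by have := x0 i (mem_index_enum i); rewrite -expr2 sqrf_eq0.
Qed.

Lemma qf_continuous {R : realType} {k : nat} (M : 'M[R]_k) :
  continuous (fun v : 'rV[R]_k => qf M v^T).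
Proof.
have -> : (fun v : 'rV[R]_k => qf M v^T) =
  (fun v : 'rV[R]_k => \sum_j (\sum_i v 0 i * M i j) * v 0 j).
  apply/funext => v; rewrite /qf mxE; apply: eq_bigr => j _.
  by rewrite !mxE; congr (_ * _); apply: eq_bigr => i _; rewrite !mxE.
have lin j : continuous (fun v : 'rV[R]_k => \sum_i v 0 i * M i j).
  apply: continuous_big => [|i _ v]; first exact: add_continuous.
  by apply: continuousM; [exact: coord_continuous|exact: cst_continuous].
apply: continuous_big => [|j _ v]; first exact: add_continuous.
by apply: continuousM; [exact: lin|exact: coord_continuous].
Qed.

Lemma qfZ {R : realType} {k : nat} (M : 'M[R]_k) a x : qf M (a *: x) = a ^+ 2 * qf M x.
Proof.
by rewrite /qf [(_ *: _)^T]linearZ /= -scalemxAr -!scalemxAl !mxE mulrA expr2.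
Qed.

(* On the part of the unit sphere where M1 is nonnegative, a compact set, M0 is
   bounded above by a negative constant. *)
Lemma finsler {R : realType} {k : nat} (M0 M1 : 'M[R]_k) :
  (forall x, qf M0 x <= 0) ->
  (forall x, x != 0 -> qf M0 x = 0 -> qf M1 x < 0) ->
  exists2 d : R, 0 < d &
    forall e, 0 < e <= d -> forall x, x != 0 -> qf M0 x + e * qf M1 x < 0.
Proof.
move=> M0le0 M1lt0.
pose q (M : 'M[R]_k) (v : 'rV[R]_k) := qf M v^T.
pose K := [set v : 'rV[R]_k | `|v| = 1 /\ 0 <= q M1 v].
(* Both forms are homogeneous of degree 2, so [x] may be scaled to norm 1; where [qf M1] is
   negative, [qf M0 <= 0] already suffices for any [e > 0]. *)
suff [d d0 dP] : exists2 d : R, 0 < d &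
    forall e, 0 < e <= d -> forall v, K v -> q M0 v + e * q M1 v < 0.
  exists d => // e ed x x0.
  have nx0 : 0 < `|x^T| by rewrite normr_gt0 -trmx0 (inj_eq trmx_inj).
  set y := `|x^T|^-1 *: x.
  have xE : x = `|x^T| *: y by rewrite scalerA divff ?scale1r// gt_eqF.
  have qE M : qf M x = `|x^T| ^+ 2 * qf M y by rewrite -qfZ -xE.
  rewrite !qE mulrCA -mulrDr pmulr_rlt0 ?exprn_gt0//.
  have y0 : y != 0 by rewrite scaler_eq0 negb_or x0 invr_eq0 gt_eqF.
  have [q1|q1] := leP 0 (qf M1 y).
    have := dP e ed y^T; rewrite /K /q /= trmxK; apply; split => //.
    by rewrite linearZ /= normrZ normfV normr_id mulVf// gt_eqF.
  by case/andP: ed => e0 _; have := M0le0 y; nra.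
have [K0|/set0P K0] := eqVneq K set0.
  by exists 1 => // e _ v; rewrite K0.
have cK : compact K.
  apply: bounded_closed_compact.
    exists 1; split => // M M1' v [v1 _].
    have {}v1 : `|v| <= 1 by rewrite v1.
    exact: le_trans v1 (ltW M1').
  apply: closedI.
    apply: (@preimage_closed _ _ (fun v : 'rV[R]_k => `|v|) [set 1]) => //.
      by move=> v _; exact: norm_continuous.
  apply: (@preimage_closed _ _ (q M1) [set y | 0 <= y]); last exact: closed_ge.
  by move=> v _; exact: qf_continuous.
have cw M : {within K, continuous (q M)}.
  by apply: continuous_subspaceT; exact: qf_continuous.
have [a aK aP] := EVT_max_rV K0 cK (cw M0).
have [b bK bP] := EVT_max_rV K0 cK (cw M1).
move: aK bK; rewrite !inE => -[a1 qa] [b1 qb].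
have a0 : a^T != 0.
  by rewrite -trmx0 (inj_eq trmx_inj) -normr_eq0 a1 oner_eq0.
have qa0 : q M0 a < 0.
  rewrite lt_neqAle (M0le0 a^T) andbT; apply/eqP => qa0.
  by have := M1lt0 _ a0 qa0; rewrite ltNge (qa : 0 <= qf M1 a^T).
(* With [a], [b] maximizing [q M0], [q M1] on [K], the value at [v] is at most
   [q M0 a + e * q M1 b], which is less than [q M0 a + e * (q M1 b + 1) <= 0]. The [+ 1] keeps the
   denominator positive and makes the bound strict. *)
exists (- q M0 a / (q M1 b + 1)); first by rewrite divr_gt0 ?oppr_gt0// ltr_wpDl.
move=> e /andP[e0]; rewrite ler_pdivlMr ?ltr_wpDl// => ed v vK.
have := aP v; have := bP v; rewrite !inE => /(_ vK) h1 /(_ vK) h2.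
nra.
Qed.

(** * Lyapunov matrices *)

Import ComplexField.Normc.

Lemma normc_ReIm (R : realType) (x : R[i]) :
  normc x = Num.sqrt (complex.Re x ^+ 2 + complex.Im x ^+ 2).
Proof. by case: x. Qed.

Lemma normc_ge0 (R : realType) (x : R[i]) : 0 <= normc x.
Proof. by rewrite normc_ReIm sqrtr_ge0. Qed.

Lemma sqr_normc_ReIm (R : realType) (x : R[i]) :
  normc x ^+ 2 = complex.Re x ^+ 2 + complex.Im x ^+ 2.
Proof. by rewrite normc_ReIm sqr_sqrtr// addr_ge0// sqr_ge0. Qed.

(** Cauchy-Schwarz in the plane: the squares differ by $(ad-bc)^2$. *)
Lemma Re_conjM_le (R : realType) (x y : R[i]) : complex.Re (x^*%C * y) <= normc x * normc y.
Proof.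
apply: (le_trans (ler_norm _)).
rewrite -(@ler_pXn2r _ 2)// ?nnegrE ?mulr_ge0 ?normc_ge0//.
rewrite real_normK ?num_real// exprMn !sqr_normc_ReIm.
case: x => a b; case: y => c d /=.
by have := sqr_ge0 (a * d - b * c); lra.
Qed.

Lemma Re_sum (R : realType) (I : finType) (F : I -> R[i]) :
  complex.Re (\sum_i F i) = \sum_i complex.Re (F i).
Proof. by apply: (big_morph (@complex.Re R)) => // -[a b] [c d]. Qed.

Lemma Im_sum (R : realType) (I : finType) (F : I -> R[i]) :
  complex.Im (\sum_i F i) = \sum_i complex.Im (F i).
Proof. by apply: (big_morph (@complex.Im R)) => // -[a b] [c d]. Qed.

(** Here triangular means lower triangular, so row [i] couples [y i 0] only to coordinates [j <= i].
    Weighting coordinate [i] by [h ^+ i] multiplies the coupling by [h ^+ (i - j)], which is at most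
    [h] off the diagonal. *)
Lemma lyapunov_trig {R : realType} {n : nat} (T : 'M[R[i]]_n) :
  is_trig_mx T -> (forall i, complex.Re (T i i) < 0) ->
  exists2 d : 'I_n -> R, forall i, 0 < d i &
    forall y : 'cV[R[i]]_n, y != 0 ->
      \sum_i d i * complex.Re ((y i 0)^*%C * (T *m y) i 0) < 0.
Proof.
move=> /is_trig_mxP Ttrig ReT.
pose c := \big[Num.min/1]_i (- complex.Re (T i i)).
have c0 : 0 < c by apply: lt_bigmin => // i _; rewrite oppr_gt0.
have cP i : complex.Re (T i i) <= - c by rewrite lerNr bigmin_le_cond.
pose M := \sum_i \sum_j normc (T i j).
have M0 : 0 <= M by rewrite !sumr_ge0// => i _; rewrite sumr_ge0// => j _; exact: normc_ge0.
have MP i j : normc (T i j) <= M.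
  rewrite /M (bigD1 i)//= (bigD1 j)//= -addrA ler_wpDr// addr_ge0 ?sumr_ge0//.
    by move=> *; exact: normc_ge0.
  by move=> k _; rewrite sumr_ge0// => *; exact: normc_ge0.
have Mn0 : 0 <= M * n%:R by rewrite mulr_ge0.
(* The denominator exceeds both [c] and [M * n%:R]: the first gives [h <= 1], the second makes the
   total coupling [h * (M * n%:R)] smaller than the margin [c]. *)
pose h := c / (M * n%:R + c + 1).
have den0 : 0 < M * n%:R + c + 1 by lra.
have h0 : 0 < h by rewrite divr_gt0.
have h0' := ltW h0.
have h1 : h <= 1 by rewrite ler_pdivrMr//; lra.
have hMn : h * (M * n%:R) < c by rewrite mulrAC ltr_pdivrMr// ltr_pM2l//; lra.
clearbody h M c.
exists (fun i : 'I_n => (h ^+ i) ^+ 2) => [i|y y0]; first by rewrite !exprn_gt0.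
pose a (i : 'I_n) := h ^+ i * normc (y i 0).
have a0 i : 0 <= a i by rewrite mulr_ge0 ?exprn_ge0 ?normc_ge0 ?ltW.
(* Entries above the diagonal vanish, diagonal ones contribute the decay [- c], and those below are
   split evenly between [a i ^+ 2] and [a j ^+ 2]. *)
have term (i j : 'I_n) : (h ^+ i) ^+ 2 * complex.Re ((y i 0)^*%C * (T i j * y j 0)) <=
    (i == j)%:R * (- c * a i ^+ 2) + h * M * ((a i ^+ 2 + a j ^+ 2) / 2).
  have hM0 : 0 <= h * M by rewrite mulr_ge0// ltW.
  case: (ltngtP i j) => [ij|ji|/val_inj <-].
  - rewrite (Ttrig _ _ ij) mul0r mulr0 mulr0.
    rewrite (_ : (i == j) = false) ?mul0r ?add0r; last by apply/eqP => e; rewrite e ltnn in ij.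
    by rewrite mulr_ge0// divr_ge0// addr_ge0// sqr_ge0.
  - rewrite (_ : (i == j) = false) ?mul0r ?add0r; last by apply/eqP => e; rewrite e ltnn in ji.
    apply: (@le_trans _ _ (h * M * (a i * a j))); last first.
      by rewrite ler_wpM2l//; have := sqr_ge0 (a i - a j); lra.
    apply: (@le_trans _ _ ((h ^+ i) ^+ 2 * (normc (y i 0) * normc (T i j * y j 0)))).
      by rewrite ler_wpM2l ?sqr_ge0// Re_conjM_le.
    rewrite normcM /a.
    have -> : h ^+ i = h ^+ (i - j) * h ^+ j by rewrite -exprD subnK// ltnW.
    have hij : h ^+ (i - j) <= h by rewrite -[leRHS]expr1 ler_wiXn2l// ?ltW// subn_gt0.
    have H : h ^+ (i - j) * normc (T i j) <= h * M.
      by rewrite ler_pM// ?exprn_ge0 ?normc_ge0.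
    set X := normc (y i 0); set Y := normc (y j 0); set t := normc _ in H *.
    set u := h ^+ (i - j) in H *; set v := h ^+ j.
    have -> : (u * v) ^+ 2 * (X * (t * Y)) = (u * t) * (u * v * X * (v * Y)) by ring.
    by rewrite ler_wpM2r//; do ![apply: mulr_ge0]; rewrite ?exprn_ge0 ?normc_ge0.
  - rewrite eqxx mul1r.
    apply: (@le_trans _ _ (- c * a i ^+ 2)); last first.
      by rewrite lerDl mulr_ge0// divr_ge0// addr_ge0// sqr_ge0.
    have -> : complex.Re ((y i 0)^*%C * (T i i * y i 0)) = complex.Re (T i i) * normc (y i 0) ^+ 2.
      rewrite sqr_normc_ReIm; case: (y i 0) => p q; case: (T i i) => r s /=; ring.
    by rewrite mulrCA /a exprMn ler_wpM2r// mulr_ge0// sqr_ge0.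
pose S := \sum_i a i ^+ 2.
have S0 : 0 < S.
  have [i yi0] : exists i, y i 0 != 0.
    apply/existsP; apply: contraNT y0; rewrite negb_exists => /forallP y0.
    by apply/eqP/colP => i; rewrite mxE; apply/eqP; have := y0 i; rewrite negbK.
  rewrite /S (bigD1 i)//= ltr_wpDr ?sumr_ge0//; first by move=> *; exact: sqr_ge0.
  rewrite exprn_gt0// mulr_gt0 ?exprn_gt0// lt_neqAle normc_ge0 andbT eq_sym.
  by apply: contra yi0 => /eqP/eq0_normc ->.
(* Each [a i ^+ 2] occurs [n] times as a row and [n] times as a column term, with factor 1/2. *)
apply: (@le_lt_trans _ _ (- c * S + h * M * (n%:R * S))); last by nra.
apply: (@le_trans _ _ (\sum_i \sum_j
    ((i == j)%:R * (- c * a i ^+ 2) + h * M * ((a i ^+ 2 + a j ^+ 2) / 2)))).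
  apply: ler_sum => i _; rewrite mxE mulr_sumr Re_sum mulr_sumr.
  by apply: ler_sum => j _; exact: term.
under eq_bigr do rewrite big_split /= -mulr_suml.
rewrite big_split /= lerD//.
  rewrite /S mulr_sumr; apply: ler_sum => i _.
  rewrite (bigD1 i)//= eqxx big1 ?addr0 ?mul1r// => j.
  by rewrite eq_sym => /negbTE ->.
under eq_bigr do rewrite -mulr_sumr -mulr_suml big_split /= sumr_const card_ord.
rewrite -mulr_sumr -mulr_suml big_split /= sumr_const card_ord sumrMnl -/S.
by rewrite -[S *+ n]mulr_natl ler_wpM2l ?mulr_ge0//; lra.
Qed.

Lemma lyapunov {R : realType} {n : nat} (A : 'M[R]_n) : hurwitz A ->
  exists P : 'M[R]_n, pd P /\ forall x, x != 0 -> ip (P *m x) (A *m x) < 0.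
Proof.
case: n A => [|n] A hA.
  by exists 1%:M; split; [split=> [|x]; rewrite ?trmx1|move=> x]; rewrite // (flatmx0 x) eqxx.
pose toC k l := map_mx (fun x : R => x%:C%C) : 'M[R]_(k, l) -> 'M[R[i]]_(k, l).
have [S Su Strig] := Schur (toC _ _ A) (ltn0Sn n).
have {Su}Su : S \in unitmx by exact: spectral.unitarymx_unit.
pose T := conjmx S (toC _ _ A).
have TS : T *m S = S *m toC _ _ A by rewrite /T conjumx// mulmxKV.
(* A diagonal entry of the triangular [T] is a root of its characteristic polynomial, hence an
   eigenvalue of the similar matrix [A]. *)
have ReT i : complex.Re (T i i) < 0.
  apply: hA; have Sf : row_free S by rewrite row_free_unit.
  apply: (@eigenvalue_conjmx _ _ _ S) => //.
    by rewrite submx_full// row_full_unit.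
  rewrite -topredE /= eigenvalue_root_char -/T char_poly_trig// rootE horner_prod (bigD1 i)//=.
  by rewrite hornerXsubC subrr mul0r.
have [d d0 dP] := lyapunov_trig T Strig ReT.
pose S1 := map_mx (@complex.Re R) S; pose S2 := map_mx (@complex.Im R) S.
pose D := diag_mx (\row_i d i).
(* The real part of $S^*DS$; on real vectors its form is the real part of the Hermitian one, which
   is what [PE] records. *)
pose P := S1^T *m D *m S1 + S2^T *m D *m S2.
have PT : P^T = P.
  by rewrite /P linearD /= !trmx_mul !trmxK tr_diag_mx !mulmxA.
have SE x i : (S *m toC _ _ x) i 0 = ((S1 *m x) i (0 : 'I_1) +i* (S2 *m x) i 0)%C.
  rewrite !mxE; apply/eqP; rewrite eq_complex Re_sum Im_sum /=.
  by apply/andP; split; apply/eqP; apply: eq_bigr => j _; rewrite !mxE;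
    case: (S i j) => a b /=; ring.
have PE x w : ip (P *m x) w =
    \sum_i d i * complex.Re (((S *m toC _ _ x) i 0)^*%C * (S *m toC _ _ w) i 0).
  rewrite /P mulmxDl ipDl -!mulmxA [ip (S1^T *m _) _]ip_mull [ip (S2^T *m _) _]ip_mull.
  rewrite !trmxK !ipE -big_split /=; apply: eq_bigr => i _.
  by rewrite !SE /D !mul_diag_mx [(\matrix_(_, _) _) _ _]mxE [X in _ + X * _]mxE
    [(\row__ _) _ _]mxE /=; ring.
have inj x : x != 0 -> S *m toC _ 1%N x != 0.
  apply: contra => /eqP Sx; apply/eqP/matrixP => i j.
  have := congr1 (fun M => invmx S *m M) Sx; rewrite mulmx0 mulKmx// => /matrixP/(_ i j).
  by rewrite !mxE => -[].
exists P; split; last first.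
  move=> x /inj/dP; rewrite PE mulmxA TS -mulmxA.
  by rewrite (_ : toC _ _ A *m toC _ _ x = toC _ _ (A *m x)) // [RHS]map_mxM.
split => // x /inj Sx; rewrite -mulmxA -/(ip x (P *m x)) ipC PE.
have [i yi0] : exists i, (S *m toC _ _ x) i 0 != 0.
  apply/existsP; apply: contraNT Sx; rewrite negb_exists => /forallP y0.
  by apply/eqP/colP => i; rewrite [RHS]mxE; apply/eqP; have := y0 i; rewrite negbK.
have ReE (z : R[i]) : complex.Re (z^*%C * z) = normc z ^+ 2.
  by rewrite sqr_normc_ReIm; case: z => a b /=; ring.
rewrite (bigD1 i)//= ltr_wpDr ?sumr_ge0//.
  by move=> j _; rewrite ReE mulr_ge0 ?sqr_ge0// ltW.
rewrite ReE mulr_gt0// exprn_gt0// lt_neqAle normc_ge0 andbT eq_sym.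
by apply: contra yi0 => /eqP/eq0_normc ->.
Qed.

(** * Linear matrix inequalities *)

Definition lmi_mx {R : realType} {N M : nat} (A : 'M[R]_N) (B : 'M[R]_(N, M))
    (C : 'M[R]_(M, N)) (P : 'M[R]_N) (Xi : 'M[R]_(M + M)) : 'M[R]_(N + M) :=
  block_mx (A^T *m P + P *m A) (P *m B) (B^T *m P) 0
  + block_mx C^T 0 0 1%:M *m Xi *m block_mx C 0 0 1%:M.

Lemma qfD {R : realType} {k : nat} (M N : 'M[R]_k) x : qf (M + N) x = qf M x + qf N x.
Proof. by rewrite !qfE mulmxDl ipDr. Qed.

Lemma qfZM {R : realType} {k : nat} a (M : 'M[R]_k) x : qf (a *: M) x = a * qf M x.
Proof. by rewrite !qfE -scalemxAl ipZr. Qed.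

Lemma qf_mul {R : realType} {k l : nat} (M : 'M[R]_k) (T : 'M[R]_(k, l)) x :
  qf (T^T *m M *m T) x = qf M (T *m x).
Proof. by rewrite !qfE -!mulmxA ip_mull. Qed.

(** The first term is the derivative of $z^TPz$ along $\dot z=Az+Bv$, the second the quadratic
    constraint on output and input. *)
Lemma lmi_mxE {R : realType} {N M : nat} (A : 'M[R]_N) (B : 'M[R]_(N, M))
    (C : 'M[R]_(M, N)) (P : 'M[R]_N) (Xi : 'M[R]_(M + M)) z v :
  P^T = P ->
  qf (lmi_mx A B C P Xi) (col_mx z v) =
    2 * ip (P *m z) (A *m z + B *m v) + qf Xi (col_mx (C *m z) v).
Proof.
move=> PT; rewrite qfD; congr (_ + _).
  rewrite qfE mul_block_col ip_col_mx mul0mx addr0 mulmxDl !ipDr -!mulmxA.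
  rewrite -[ip z (A^T *m _)]ip_mull -[ip v _]ip_mull !(ip_mull P) PT.
  by rewrite [ip (A *m z) _]ipC [ip (B *m v) _]ipC !(ip_mull P) PT; ring.
have -> : block_mx C^T 0 0 1%:M = (block_mx C 0 0 1%:M : 'M[R]_(M + M, N + M))^T.
  by rewrite tr_block_mx !trmx0 trmx1.
by rewrite qf_mul mul_block_col !mul0mx mul1mx addr0 add0r.
Qed.

Lemma lmi_mxT {R : realType} {N M : nat} (A : 'M[R]_N) (B : 'M[R]_(N, M))
    (C : 'M[R]_(M, N)) (P : 'M[R]_N) (Xi : 'M[R]_(M + M)) :
  P^T = P -> Xi^T = Xi -> (lmi_mx A B C P Xi)^T = lmi_mx A B C P Xi.
Proof.
move=> PT XiT; rewrite /lmi_mx linearD /= !trmx_mul !tr_block_mx linearD /=.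
by rewrite !trmx_mul !trmxK PT XiT !trmx0 trmx1 mulmxA [X in block_mx X]addrC.
Qed.

(** [E] and [F] read off the fast and slow coordinates. [A0] moves only the fast one, through [A];
    on the manifold [E z = 0], the slow coordinate and the output follow the reduced system [Ar],
    [Br], [Cr]. *)
Lemma singular_perturbation {R : realType} {n k N M : nat} (A Px : 'M[R]_n)
    (E : 'M[R]_(n, N)) (F : 'M[R]_(k, N)) (A0 A1 : 'M[R]_N) (Ar Pr : 'M[R]_k)
    (B : 'M[R]_(N, M)) (Br : 'M[R]_(k, M)) (C : 'M[R]_(M, N))
    (Cr : 'M[R]_(M, k)) (G : 'M[R]_(M, n)) (Xi : 'M[R]_(M + M)) :
  (forall z : 'cV[R]_N, E *m z = 0 -> F *m z = 0 -> z = 0) ->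
  E *m A0 = A *m E -> F *m A0 = 0 -> F *m A1 = Ar *m F -> F *m B = Br ->
  C = Cr *m F + G *m E -> Xi^T = Xi ->
  pd Px -> (forall x, x != 0 -> ip (Px *m x) (A *m x) < 0) ->
  pd Pr -> (forall s, s != 0 -> qf (lmi_mx Ar Br Cr Pr Xi) s < 0) ->
  exists (eps rho : R) (P : 'M[R]_N),
    [/\ 0 < eps, 0 < rho, pd P &
        LMI (eps^-1 *: A0 + A1 + rho%:M) B C P Xi].
Proof.
move=> EFinj EA FA0 FA1 FB CE XiT [PxT Pxpd] PxA [PrT Prpd] rneg.
pose P := E^T *m Px *m E + F^T *m Pr *m F.
have PT : P^T = P by rewrite /P linearD /= !trmx_mul !trmxK PxT PrT !mulmxA.
have PE z w : ip (P *m z) w = ip (Px *m (E *m z)) (E *m w) + ip (Pr *m (F *m z)) (F *m w).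
  by rewrite /P mulmxDl ipDl -!mulmxA [ip (E^T *m _) _]ip_mull [ip (F^T *m _) _]ip_mull !trmxK.
have Ppd : pd P.
  split=> // z z0; rewrite -/(qf P z) qfE ipC PE.
  have hx x : 0 <= ip (Px *m x) x.
    have [->|x0] := eqVneq x 0; first by rewrite ip0r.
    by rewrite ipC -qfE; exact/ltW/Pxpd.
  have hr x : 0 <= ip (Pr *m x) x.
    have [->|x0] := eqVneq x 0; first by rewrite ip0r.
    by rewrite ipC -qfE; exact/ltW/Prpd.
  have [Ez|Ez] := eqVneq (E *m z) 0.
    have [Fz|Fz] := eqVneq (F *m z) 0; first by rewrite (EFinj z) ?eqxx in z0.
    by rewrite ltr_wpDl// ipC -qfE; exact: Prpd.
  by rewrite ltr_pwDl// ipC -qfE; exact: Pxpd.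
(* The target form is affine in the state matrix: [M0] is the coefficient of [eps^-1], [M2] that of
   [rho], and [M1] carries the inputs and [Xi]. *)
pose M0 := lmi_mx A0 (0 : 'M[R]_(N, M)) 0 P 0.
pose M1 := lmi_mx A1 B C P Xi.
pose M2 := lmi_mx 1%:M (0 : 'M[R]_(N, M)) 0 P 0.
have M0E z v : qf M0 (col_mx z v) = 2 * ip (Px *m (E *m z)) (A *m (E *m z)).
  rewrite lmi_mxE// [qf 0 _]qfE !mul0mx ip0r !addr0 PE.
  by rewrite [F *m (_ *m _)]mulmxA FA0 mul0mx ip0r addr0 [E *m (_ *m _)]mulmxA EA -mulmxA.
have M0le0 s : qf M0 s <= 0.
  rewrite -[s]vsubmxK M0E pmulr_rle0//.
  have [->|x0] := eqVneq (E *m usubmx s) 0; first by rewrite !mulmx0 ip0r.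
  exact/ltW/PxA.
(* Where [M0] vanishes the Lyapunov inequality forces [E *m z = 0], and [M1] then equals the slow
   form at [(F z, v)]. *)
have M01 s : s != 0 -> qf M0 s = 0 -> qf M1 s < 0.
  rewrite -[s]vsubmxK; move: (usubmx s) (dsubmx s) => z v s0 /eqP.
  rewrite M0E mulf_eq0 pnatr_eq0 /= => Ez0.
  have {Ez0}Ez0 : E *m z = 0.
    apply/eqP; apply: contraTT Ez0 => /PxA.
    by rewrite lt_neqAle => /andP[].
  have : col_mx (F *m z) v != 0.
    apply: contra s0; rewrite !col_mx_eq0 => /andP[/eqP Fz0 ->]; rewrite andbT.
    by rewrite (EFinj z).
  move=> /rneg; rewrite !lmi_mxE// PE Ez0 mulmx0 ip0l add0r mulmxDr.
  rewrite CE mulmxDl -!mulmxA Ez0 mulmx0 addr0.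
  by rewrite [F *m (A1 *m _)]mulmxA FA1 [F *m (B *m _)]mulmxA FB -mulmxA.
have [eps eps0 epsP] := finsler M0 M1 M0le0 M01.
have M01neg s : s != 0 -> qf (eps^-1 *: M0 + M1) s < 0.
  move=> s0; rewrite qfD qfZM -(pmulr_rlt0 _ eps0) mulrDr mulrA divff ?gt_eqF// mul1r.
  by apply: epsP; rewrite ?lexx ?andbT.
(* The first form is now negative definite, so the condition on its zero set is vacuous. *)
have [||rho rho0 rhoP] := finsler (eps^-1 *: M0 + M1) M2.
- move=> s; have [->|s0] := eqVneq s 0; last exact/ltW/M01neg.
  by rewrite qfE ip0l.
- by move=> s /M01neg + s0; rewrite s0 ltxx.
exists eps, rho, P; split => //; rewrite /LMI -/(lmi_mx _ _ _ _ _); split; first exact: lmi_mxT.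
move=> s; rewrite -/(qf _ s).
have [->|s0] := eqVneq s 0; first by rewrite qfE ip0l.
have := rhoP rho; rewrite rho0 lexx => /(_ isT _ s0) /ltW; apply: le_trans.
rewrite -[s]vsubmxK [qf (_ *: _ + _) _]qfD qfZM !lmi_mxE// [qf 0 _]qfE !mul0mx ip0r !addr0.
by rewrite !mulmxDl -!scalemxAl mul1mx mul_scalar_mx !ipDr !ipZr; lra.
Qed.

(** * The LMI of the slow subsystem *)

Lemma psd_ker {R : realType} {k : nat} (Q : 'M[R]_k) x :
  psd Q -> qf Q x = 0 -> Q *m x = 0.
Proof.
move=> [QT Qge0] Qx0; apply: ip_eq0; set y := Q *m x; set a := ip y y.
pose b := qf Q y; have b0 : 0 <= b by exact: Qge0.
(* The step t nearly minimizes t |-> qf Q (x + t y) = 2 t a + t^2 b. *)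
pose t := - a / (b + 1).
have ta : a = - (t * (b + 1)) by rewrite /t mulfVK ?opprK// gt_eqF// ltr_wpDl.
have : 0 <= qf Q (x + t *: y) by exact: Qge0.
have -> : qf Q (x + t *: y) = 2 * t * a + t ^+ 2 * b.
  rewrite qfE mulmxDr -scalemxAr !ipDl !ipDr !ipZl !ipZr -!qfE Qx0 -/b.
  rewrite (_ : ip x (Q *m y) = a); last by rewrite -[X in X *m y]QT -ip_mull.
  by rewrite -/y -/a; ring.
move=> h; have t0 : t ^+ 2 <= 0 by rewrite ta in h; nra.
have {}t0 : t = 0 by apply/eqP; rewrite -sqrf_eq0 eq_le t0 sqr_ge0.
by rewrite ta t0 mul0r oppr0.
Qed.

(** Picks the multiplier of a sector constraint. For [L != 0], [phi = mu / L] cancels the cross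
    term; for [L = 0], [phi = mu ^+ 2 / d] completes the square of [d *: x + mu *: v]. In dimension
    0 every term vanishes, whatever the sign of [L]. *)
Lemma cross_term_bound {R : realType} {k : nat} (L mu d : R) :
  0 <= L \/ k = 0%N -> 0 < mu -> 0 < d ->
  exists2 phi, 0 < phi & forall x v : 'cV[R]_k,
    2 * (phi * L - mu) * ip x v - phi * ip v v <= d * ip x x.
Proof.
move=> [L0|->] mu0 d0; last first.
  by exists 1 => // x v; rewrite (flatmx0 x) (flatmx0 v) !ip0r !mulr0 subr0.
have [->|L1] := eqVneq L 0.
  exists (mu ^+ 2 / d) => [|x v]; first by rewrite divr_gt0// exprn_gt0.
  have := ip_ge0 (d *: x + mu *: v); rewrite !ipDl !ipDr !ipZl !ipZr [ip v x]ipC => h.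
  have e : d * (mu ^+ 2 / d * ip v v) = mu ^+ 2 * ip v v.
    by rewrite mulrA mulrCA divff ?mulr1// gt_eqF.
  by rewrite mulr0 sub0r -(ler_pM2l d0) mulrBr e; lra.
exists (mu / L) => [|x v]; first by rewrite divr_gt0// lt_neqAle eq_sym L1.
rewrite mulfVK// subrr mulr0 mul0r sub0r.
have := ip_ge0 x; have := ip_ge0 v; have : 0 <= mu / L by rewrite divr_ge0// ltW.
by move=> a b c; rewrite (@le_trans _ _ 0)// ?oppr_le0 mulr_ge0// ltW.
Qed.

Lemma XimatE {R : realType} {p r1 r2 : nat} (hLf Lh phi1 phi2 : R)
    (a1 v1 : 'cV[R]_p) (a2 v2 : 'cV[R]_r1) (a3 v3 : 'cV[R]_r2) :
  qf (Ximat hLf Lh phi1 phi2)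
     (col_mx (col_mx (col_mx a1 a2) a3) (col_mx (col_mx v1 v2) v3)) =
  2 * (phi1 * hLf * ip a1 v1 + phi2 * Lh * ip a2 v2 + ip a3 v3
       - phi1 * ip v1 v1 - phi2 * ip v2 v2 - ip v3 v3).
Proof.
rewrite qfE /Ximat !mul_block_col !mul0mx !addr0 !add0r !mul_scalar_mx.
rewrite !ip_col_mx !add_col_mx !ip_col_mx !ipDr !ipZr.
rewrite [ip v1 a1]ipC [ip v2 a2]ipC [ip v3 a3]ipC; ring.
Qed.

Lemma XimatT {R : realType} {p r1 r2 : nat} (hLf Lh phi1 phi2 : R) :
  (@Ximat R p r1 r2 hLf Lh phi1 phi2)^T = Ximat hLf Lh phi1 phi2.
Proof. by rewrite /Ximat !tr_block_mx !trmx0 !tr_scalar_mx. Qed.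

(* The system matrices obtained for infinitely fast plant dynamics, that is with
   x replaced by its steady state - A^-1 B u. *)
Definition slowA {R : realType} {p r2 : nat} (Q : 'M[R]_r2) (m mu gamma : R) :
  'M[R]_(p + r2) := block_mx (- m%:M) 0 0 (- mu%:M - gamma *: Q).

Definition slowB {R : realType} {p r1 r2 : nat} (Pi1 : 'M[R]_(r1, p))
    (Pi2 : 'M[R]_(r2, p)) (mu : R) : 'M[R]_(p + r2, p + r1 + r2) :=
  block_mx (row_mx (- 1%:M) (- Pi1^T)) (- (mu^-1 *: Pi2^T)) 0 1%:M.

Definition slowC {R : realType} {p r1 r2 : nat} (Pi1 : 'M[R]_(r1, p))
    (Pi2 : 'M[R]_(r2, p)) (mu : R) : 'M[R]_(p + r1 + r2, p + r2) :=
  block_mx (col_mx 1%:M Pi1) 0 Pi2 mu%:M.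

Lemma slow_lmi {R : realType} {p r1 r2 : nat} (Pi1 : 'M[R]_(r1, p))
    (Pi2 : 'M[R]_(r2, p)) (Q : 'M[R]_r2) (m mu gamma hLf Lh : R) :
  0 < m -> 0 < mu -> 0 < gamma -> 0 <= hLf \/ p = 0%N -> 0 <= Lh \/ r1 = 0%N ->
  psd Q -> (forall x : 'cV[R]_r2, Pi2 *m Pi2^T *m x = 0 -> Q *m x = 0 -> x = 0) ->
  exists (phi1 phi2 : R) (P : 'M[R]_(p + r2)),
    [/\ 0 < phi1, 0 < phi2, pd P & forall s, s != 0 ->
      qf (lmi_mx (slowA Q m mu gamma) (slowB Pi1 Pi2 mu) (slowC Pi1 Pi2 mu) P
                 (Ximat hLf Lh phi1 phi2)) s < 0].
Proof.
move=> m0 mu0 ga0 hLf0 Lh0 Qpsd Qker.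
(* Strong convexity yields $-2\mu m\|u\|^2$. Each of the two cross terms, with [v1] and with [v2],
   may consume $\frac{\mu m}{2}\|u\|^2$, which leaves $-\mu m\|u\|^2$. *)
have mum0 : 0 < mu * m / 2 by rewrite divr_gt0// mulr_gt0.
have [phi1 phi10 phi1P] := cross_term_bound hLf mu (mu * m / 2) hLf0 mu0 mum0.
have [d2 d20 d2P] : exists2 d : R, 0 < d &
    forall u : 'cV[R]_p, d * ip (Pi1 *m u) (Pi1 *m u) <= mu * m / 2 * ip u u.
  have [u|u u0|d d0 dP] := finsler (- (mu * m / 2))%:M (Pi1^T *m Pi1).
  - by rewrite qfE mul_scalar_mx ipZr mulNr oppr_le0 mulr_ge0 ?ip_ge0// ltW.
  - move=> /eqP; rewrite qfE mul_scalar_mx ipZr mulf_eq0 oppr_eq0 gt_eqF//=.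
    by move=> /eqP/ip_eq0 u00; rewrite u00 eqxx in u0.
  exists d => // u; have [->|u0] := eqVneq u 0; first by rewrite mulmx0 !ip0r !mulr0.
  have := dP d _ u u0; rewrite d0 lexx => /(_ isT).
  by rewrite !qfE -mulmxA -[ip u (Pi1^T *m _)]ip_mull mul_scalar_mx ipZr; lra.
have [phi2 phi20 phi2P] := cross_term_bound Lh mu d2 Lh0 mu0 d20.
pose P1 : 'M[R]_(p + r2) := block_mx 0 Pi2^T Pi2 0.
have P1T : P1^T = P1 by rewrite /P1 tr_block_mx trmxK !trmx0.
set A := slowA Q m mu gamma; set B := slowB Pi1 Pi2 mu.
set C := slowC Pi1 Pi2 mu; pose Xi := @Ximat R p r1 r2 hLf Lh phi1 phi2.
pose M0 := lmi_mx A B C mu%:M Xi.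
pose M1 := lmi_mx A B 0 P1 0.
have ABE u l v1 v2 v3 : A *m col_mx u l + B *m col_mx (col_mx v1 v2) v3 =
    col_mx (- m *: u - v1 - Pi1^T *m v2 - mu^-1 *: (Pi2^T *m v3))
           (- mu *: l - gamma *: (Q *m l) + v3).
  rewrite /A /B !mul_block_col mul_row_col add_col_mx !mul0mx addr0 !add0r mul1mx.
  by rewrite mulmxDl !mulNmx !mul_scalar_mx scale1r -!scalemxAl !scaleNr !addrA.
(* With [P = mu%:M] the coupling of [u] and [v3] cancels against the [Pi2 *m u] part of the output,
   and the terms in [l] and [v3] form a square. *)
have M0le u l v1 v2 v3 :
    qf M0 (col_mx (col_mx u l) (col_mx (col_mx v1 v2) v3)) <=
    - (mu * m * ip u u + phi1 * ip v1 v1 + phi2 * ip v2 v2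
       + 2 * ip (v3 - mu *: l) (v3 - mu *: l) + 2 * mu * gamma * qf Q l).
  rewrite lmi_mxE ?tr_scalar_mx// ABE mul_scalar_mx scale_col_mx ip_col_mx.
  have -> : C *m col_mx u l = col_mx (col_mx u (Pi1 *m u)) (Pi2 *m u + mu *: l).
    by rewrite /C mul_block_col mul_col_mx mul1mx mul0mx addr0 mul_scalar_mx.
  rewrite XimatE !(ipDl, ipDr, ipNl, ipNr, ipZl, ipZr).
  rewrite -[ip u (Pi1^T *m _)]ip_mull -[ip u (Pi2^T *m _)]ip_mull -qfE.
  have := phi1P u v1; have := phi2P (Pi1 *m u) v2; have := d2P u.
  have : mu * (mu^-1 * ip (Pi2 *m u) v3) = ip (Pi2 *m u) v3.
    by rewrite mulrA divff ?mul1r// gt_eqF.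
  rewrite [ip v3 l]ipC; lra.
have [||k1 k10 k1P] := finsler M0 M1.
- move=> s; rewrite -[s]vsubmxK -[usubmx s]vsubmxK -[dsubmx s]vsubmxK.
  rewrite -[usubmx (dsubmx s)]vsubmxK; apply: le_trans (M0le _ _ _ _ _) _.
  by rewrite oppr_le0 !addr_ge0// mulr_ge0 ?ip_ge0 ?mulr_ge0 ?(proj2 Qpsd)// ltW.
- move=> s; rewrite -[s]vsubmxK -[usubmx s]vsubmxK -[dsubmx s]vsubmxK.
  rewrite -[usubmx (dsubmx s)]vsubmxK.
  move: (usubmx (usubmx s)) (dsubmx (usubmx s)) (dsubmx (dsubmx s))
    (usubmx (usubmx (dsubmx s))) (dsubmx (usubmx (dsubmx s))) => u l v3 v1 v2 s0 q0.
  have := M0le u l v1 v2 v3; rewrite q0.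
  have hu : 0 <= mu * m * ip u u by rewrite !mulr_ge0 ?ip_ge0// ltW.
  have h1 : 0 <= phi1 * ip v1 v1 by rewrite !mulr_ge0 ?ip_ge0// ltW.
  have h2 : 0 <= phi2 * ip v2 v2 by rewrite !mulr_ge0 ?ip_ge0// ltW.
  have h3 := ip_ge0 (v3 - mu *: l).
  have h4 : 0 <= mu * gamma * qf Q l by rewrite !mulr_ge0 ?(proj2 Qpsd)// ltW.
  move=> h.
  have zero c k (x : 'cV[R]_k) : 0 < c -> c * ip x x = 0 -> x = 0.
    by move=> c0 /eqP; rewrite mulf_eq0 gt_eqF//= => /eqP/ip_eq0.
  have u0 : u = 0 by apply: (zero (mu * m)); [rewrite mulr_gt0|lra].
  have v10 : v1 = 0 by apply: (zero phi1) => //; lra.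
  have v20 : v2 = 0 by apply: (zero phi2) => //; lra.
  have v3l : v3 = mu *: l by apply/eqP; rewrite -subr_eq0; apply/eqP/ip_eq0; lra.
  have Ql : Q *m l = 0.
    apply: psd_ker => //; have : mu * gamma * qf Q l = 0 by lra.
    by move=> /eqP; rewrite mulf_eq0 gt_eqF ?mulr_gt0//= => /eqP.
  (* On the zero set the state derivative is [(- Pi2^T l, 0)], while [P1] sends [(0, l)] to
     [(Pi2^T l, 0)]. *)
  rewrite lmi_mxE// ABE [qf 0 _]qfE !mul0mx ip0r addr0 /P1 mul_block_col !mul0mx.
  rewrite u0 v10 v20 v3l !mulmx0 !scaler0 !addr0 !sub0r !oppr0 !add0r ip_col_mx ip0l addr0.
  rewrite -scalemxAr scalerA mulVf ?gt_eqF// scale1r ipNr mulrN oppr_lt0 mulr_gt0//.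
  rewrite lt_neqAle ip_ge0 andbT eq_sym; apply: contra s0 => /eqP/ip_eq0 Pl.
  have l0 : l = 0 by apply: Qker => //; rewrite -mulmxA Pl mulmx0.
  by rewrite u0 v10 v20 v3l l0 scaler0 !col_mx0.
(* A second bound on [k], under which [mu%:M + k *: P1] stays positive definite; both bounds survive
   decreasing [k], hence the minimum below. *)
have [s|s s0|k2 k20 k2P] := finsler (- mu)%:M (- P1).
- by rewrite qfE mul_scalar_mx ipZr mulNr oppr_le0 mulr_ge0 ?ip_ge0// ltW.
- move=> /eqP; rewrite qfE mul_scalar_mx ipZr mulf_eq0 oppr_eq0 gt_eqF//=.
  by move=> /eqP/ip_eq0 s00; rewrite s00 eqxx in s0.
pose k := Num.min k1 k2.
have k0 : 0 < k by rewrite lt_min k10.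
have PT : (mu%:M + k *: P1)^T = mu%:M + k *: P1.
  by rewrite linearD /= linearZ /= tr_scalar_mx P1T.
exists phi1, phi2, (mu%:M + k *: P1); split => //.
  split => // x x0; rewrite -/(qf _ x).
  have := k2P k _ x x0; rewrite k0 ge_min lexx orbT => /(_ isT).
  by rewrite qfD qfZM !qfE mulNmx ipNr !mul_scalar_mx !ipZr; lra.
move=> s s0; have := k1P k _ s s0; rewrite k0 ge_min lexx => /(_ isT).
rewrite -[s]vsubmxK !lmi_mxE ?tr_scalar_mx// [qf 0 _]qfE !mul0mx ip0r addr0.
by rewrite mulmxDl -scalemxAl ipDl ipZl; lra.
Qed.

(** * Convexity and smoothness constants *)

(* Divide the strong convexity inequality along the segment from u to v by the
   step h and let h tend to 0 from the right. *)
Lemma strongly_convex_derive {R : realType} {k : nat} (f : 'cV[R]_k -> R) (m : R) u v :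
  strongly_convex f m -> differentiable f u ->
  'D_(v - u) f u <= f v - f u - m / 2 * norm2 (v - u) ^+ 2.
Proof.
move=> [m0 fconv] fu; set w := v - u; set N := norm2 w ^+ 2.
have fd : (fun h : R => h^-1 *: ((f \o shift u) (h *: w) - f u)) @ 0^'+ --> 'D_w f u.
  have : (fun h : R => h^-1 *: ((f \o shift u) (h *: w) - f u)) @ 0^' --> 'D_w f u.
    exact: (diff_derivable fu).
  apply: cvg_trans; apply: cvg_app => S.
  rewrite !nbhs_filterE /at_right /dnbhs /within /= /prop_near1.
  by apply: filterS => h Sh h0; apply: Sh; rewrite gt_eqF.
have gd : (fun h : R => f v - f u - m / 2 * (1 - h) * N) @ 0^'+ -->
    f v - f u - m / 2 * (1 - 0) * N.
  apply: cvg_at_right_filter; apply: cvgB; first exact: cvg_cst.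
  apply: cvgM; last exact: cvg_cst.
  by apply: cvgM; [exact: cvg_cst|apply: cvgB; [exact: cvg_cst|exact: cvg_id]].
rewrite -[m / 2]mulr1 -{2}[1]subr0; apply: (ler_cvg_to fd gd).
near=> h.
have h0 : 0 < h by [].
have h1 : h < 1 by near: h; exact: nbhs_right_lt.
have h01 : 0 <= h <= 1 by rewrite !ltW.
have := fconv v u h h01.
have -> : h *: v + (1 - h) *: u = h *: w + u.
  by rewrite /w scalerBr scalerBl scale1r addrCA addrC.
rewrite -/w -/N /= => hf.
rewrite [h^-1 *: _]mulrC ler_pdivrMr//; lra.
Unshelve. all: by end_near. Qed.

Lemma norm2_ge0 {R : realType} {k : nat} (x : 'cV[R]_k) : 0 <= norm2 x.
Proof. exact: sqrtr_ge0. Qed.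

Lemma norm2_delta {R : realType} {k : nat} (i : 'I_k) : norm2 (delta_mx i 0 : 'cV[R]_k) = 1.
Proof.
rewrite /norm2 -/(ip _ _) ipE (bigD1 i)//= big1 => [|j /negbTE ji].
  by rewrite !mxE !eqxx mulr1 addr0 sqrtr1.
by rewrite !mxE ji mul0r.
Qed.

Lemma coord_le_norm2 {R : realType} {k : nat} (x : 'cV[R]_k) i : x i 0 <= norm2 x.
Proof.
apply: (le_trans (ler_norm _)); rewrite -sqrtr_sqr ler_sqrt; last exact: ip_ge0.
rewrite -/(ip x x) ipE (bigD1 i)//= expr2 lerDl sumr_ge0// => j _.
by rewrite -expr2 sqr_ge0.
Qed.

(* In dimension 0 the Lipschitz condition does not constrain L. *)
Lemma lipschitz_gradient_ge0 {R : realType} {k : nat} (f : 'cV[R]_k -> R) (L : R) :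
  lipschitz_gradient f L -> 0 <= L \/ k = 0%N.
Proof.
case: k f => [|k] f [_ fL]; [by right|left].
have := fL (delta_mx 0 0) 0; rewrite subr0 norm2_delta mulr1.
exact/le_trans/norm2_ge0.
Qed.

(** Adding the strong convexity inequalities at [0] and at a unit vector [e] shows that the slope
    along [e] grows by at least [m] between them, while the Lipschitz bound allows at most [L]. *)
Lemma lipschitz_gradient_ge_modulus {R : realType} {k : nat} (f : 'cV[R]_k -> R) (m L : R) :
  strongly_convex f m -> lipschitz_gradient f L -> 0 <= L - m \/ k = 0%N.
Proof.
case: k f => [|k] f fm [fd fL]; [by right|left].
pose e : 'cV[R]_k.+1 := delta_mx 0 0.
have h1 := strongly_convex_derive f m 0 e fm (fd 0).
have h2 := strongly_convex_derive f m e 0 fm (fd e).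
have h3 := coord_le_norm2 (grad f e - grad f 0) 0.
have h4 := fL e 0.
have Ne : norm2 (- e) = norm2 e by rewrite /norm2 -!/(ip _ _) ipNl ipNr opprK.
move: h1 h2 h3 h4; rewrite !subr0 sub0r !Ne norm2_delta expr1n !mulr1.
rewrite [grad]lock !mxE -lock !mxE -/e.
have -> : 'D_(- e) f e = - 'D_e f e by rewrite !deriveE// linearN.
lra.
Qed.

(** * Assembly for the full closed loop *)

Lemma lmi_feasible {R : realType} {n p r1 r2 : nat}
  (A : 'M[R]_n) (B : 'M[R]_(n, p)) (C1 : 'M[R]_(r1, n)) (C2 : 'M[R]_(r2, n))
  (m hLf Lh mu gamma : R) (Q : 'M[R]_r2) :
  hurwitz A -> 0 < mu -> 0 < m -> 0 < gamma ->
  0 <= hLf \/ p = 0%N -> 0 <= Lh \/ r1 = 0%N -> psd Q ->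
  (forall x : 'cV[R]_r2,
     Piu A B C2 *m (Piu A B C2)^T *m x = 0 -> Q *m x = 0 -> x = 0) ->
  exists (eps rho phi1 phi2 : R) (P : 'M[R]_(n + p + r2)),
    [/\ 0 < eps, 0 < rho, 0 <= phi1, 0 <= phi2 &
    pd P /\
    LMI (Amat A B Q m mu gamma eps + rho%:M)
        (Bmat (n := n) (Piu A B C1) (Piu A B C2) mu)
        (Cmat (p := p) C1 C2 mu) P
        (Ximat hLf Lh phi1 phi2)].
Proof.
move=> hA mu0 m0 ga0 hLf0 Lh0 Qpsd Qker.
have [Px [Pxpd PxA]] := lyapunov A hA.
(* A kernel vector of [A] would make the strict Lyapunov inequality read [0 < 0]. *)
have Au : A \in unitmx.
  rewrite -unitmx_tr -row_free_unit; apply: inj_row_free => v vA.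
  apply: trmx_inj; rewrite trmx0; apply/eqP; apply: contraT => /PxA.
  have -> : A *m v^T = 0 by rewrite -[A]trmxK -trmx_mul vA trmx0.
  by rewrite ip0r ltxx.
have [phi1 [phi2 [Pr [phi10 phi20 Prpd Prneg]]]] :=
  slow_lmi (Piu A B C1) (Piu A B C2) Q m mu gamma hLf Lh m0 mu0 ga0 hLf0 Lh0 Qpsd Qker.
pose E : 'M[R]_(n, n + p + r2) := row_mx (row_mx 1%:M (invmx A *m B)) 0.
pose F : 'M[R]_(p + r2, n + p + r2) := block_mx (row_mx 0 1%:M) 0 0 1%:M.
pose A0 : 'M[R]_(n + p + r2) := block_mx (block_mx A B 0 0) 0 0 0.
pose A1 : 'M[R]_(n + p + r2) :=
  block_mx (block_mx 0 0 0 (- m%:M)) 0 0 (- mu%:M - gamma *: Q).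
(* [G] is the effect of the fast variable on the output: $C_ix=C_i\xi+\Pi_{iu}u$ because
   $x=\xi-A^{-1}Bu$. *)
pose G : 'M[R]_(p + r1 + r2, n) := col_mx (col_mx 0 C1) C2.
have [||||||eps [rho [P [eps0 rho0 Ppd PLMI]]]] :=
  singular_perturbation A Px E F A0 A1 _ Pr
    (Bmat (n := n) (Piu A B C1) (Piu A B C2) mu) _ (Cmat (p := p) C1 C2 mu) _ G
    (Ximat hLf Lh phi1 phi2) _ _ _ _ _ _ (XimatT _ _ _ _) Pxpd PxA Prpd Prneg.
- move=> z; rewrite -[z]vsubmxK -[usubmx z]vsubmxK.
  move: (usubmx (usubmx z)) (dsubmx (usubmx z)) (dsubmx z) => x u l.
  rewrite /E /F mul_block_col !mul_row_col !mul0mx !mul1mx !addr0 !add0r.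
  move=> xu /eqP; rewrite col_mx_eq0 => /andP[/eqP u0 /eqP l0].
  by move: xu; rewrite u0 l0 mulmx0 addr0 => ->; rewrite !col_mx0.
- rewrite /E /A0 !(mul_row_block, mulmx0, mul0mx, addr0, mul1mx).
  by rewrite !mul_mx_row mulmx1 mulmx0 mulmxA mulmxV// mul1mx.
- rewrite /F /A0 mulmx_block !(mul_row_block, mulmx0, mul0mx, addr0).
  by rewrite row_mx0 block_mx0.
- rewrite /F /A1 /slowA.
  rewrite !(mulmx_block, mul_row_block, mulmx0, mul0mx, addr0, add0r, mul1mx, mulmx1).
  by rewrite mul_mx_row mulmx0 mulmx1.
- by rewrite /F /Bmat /slowB mulmx_block !(mul_row_col, mulmx0, mul0mx, addr0, add0r, mul1mx).
- rewrite /F /E /G /slowC /Cmat.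
  rewrite !(mulmx_block, mul_col_mx, mulmx0, mul0mx, addr0, add0r, mul1mx, mulmx1).
  rewrite !mul_mx_row !mulmx0 !mulmx1.
  have colE (X : 'M[R]_(r1, n + p)) : col_mx (0 : 'M[R]_(p, n + p + r2)) (row_mx X 0) =
      row_mx (col_mx 0 X) 0.
    by rewrite -[0 in LHS]row_mx0 -block_mxEv block_mxEh col_mx0.
  rewrite colE -block_mxEv add_block_mx add_col_mx !add_row_mx /Piu.
  by rewrite !addr0 !add0r -!mulmxA !addNr.
exists eps, rho, phi1, phi2, P; split; rewrite ?ltW//; split => //.
rewrite (_ : Amat _ _ _ _ _ _ _ = eps^-1 *: A0 + A1) //.
by rewrite /A0 /A1 /Amat !scale_block_mx !add_block_mx !scaler0 !addr0 !add0r.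
Qed.

Theorem theorem3 (R : realType) (n p q r1 r2 : nat)
  (A : 'M[R]_n) (B : 'M[R]_(n, p)) (Bw : 'M[R]_(n, q))
  (C1 : 'M[R]_(r1, n)) (D1w : 'M[R]_(r1, q))
  (C2 : 'M[R]_(r2, n)) (D2w : 'M[R]_(r2, q))
  (f : R -> 'cV[R]_p -> R) (h : R -> 'cV[R]_r1 -> R)
  (g : R -> 'cV[R]_r2 -> \bar R) (w : R -> 'cV[R]_q)
  (m Lf Lh mu : R) (Q : 'M[R]_r2) :
  hurwitz A ->
  0 < mu ->
  (* Assumption 1 *)
  (forall t, 0 <= t ->
     [/\ strongly_convex (f t) m, lipschitz_gradient (f t) Lf,
         convex_fun (h t), lipschitz_gradient (h t) Lh &
         [/\ proper_efun (g t), convex_efun (g t) &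
             lower_semicontinuous (g t)]]) ->
  (* Assumption 2 *)
  (forall t, 0 <= t ->
     exists u : 'cV[R]_p,
       (g t (Piu A B C2 *m u + Piw A Bw C2 D2w *m w t)%R < +oo)%E) ->
  (exists (us : R -> 'cV[R]_p) (ls : R -> 'cV[R]_r2),
     [/\ forall t, 0 <= t ->
           saddle_point
             (lagr (f t) (h t) (g t) (Piu A B C1) (Piw A Bw C1 D1w)
                   (Piu A B C2) (Piw A Bw C2 D2w) (w t) mu) (us t) (ls t),
         forall i : 'I_p, measurable_fun (`[0%R, +oo[%classic : set R) (fun t : R => us t i 0) &
         forall i : 'I_r2, measurable_fun (`[0%R, +oo[%classic : set R) (fun t : R => ls t i 0)]) ->
  (* hypotheses on Q and mu *)
  psd Q ->
  (forall x : 'cV[R]_r2,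
     Piu A B C2 *m (Piu A B C2)^T *m x = 0 -> Q *m x = 0 -> x = 0) ->
  Num.max (Lf - m) Lh <= mu ->
  forall gamma : R, 0 < gamma ->
  exists (eps rho phi1 phi2 : R) (P : 'M[R]_(n + p + r2)),
    [/\ 0 < eps, 0 < rho, 0 <= phi1, 0 <= phi2 &
    pd P /\
    LMI (Amat A B Q m mu gamma eps + rho%:M)
        (Bmat (n := n) (Piu A B C1) (Piu A B C2) mu)
        (Cmat (p := p) C1 C2 mu) P
        (Ximat (Lf - m) Lh phi1 phi2)].
Proof.
move=> hA mu0 asm1 _ _ Qpsd Qker _ gamma ga0.
(* The constants [m], [Lf], [Lh] are the same for all times, so their signs can be read off at time
   0. *)
have [fconv flip _ hlip _] := asm1 0 (lexx 0).
apply: lmi_feasible => //; first exact: (proj1 fconv).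
- exact: lipschitz_gradient_ge_modulus fconv flip.
- exact: lipschitz_gradient_ge0 hlip.
Qed.
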